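(* Let $\sigma_1$ be a Kubo-Ando mean on $\mathscr{P}_n(\mathbb{C})$ with representing function $f$, and let $\sigma_2$ be the Kubo-Ando mean on $\mathscr{P}_{2n}(\mathbb{R})$ corresponding to $\sigma_1$ under the embedding $\Psi$. Suppose that $A,B\in\mathscr{P}_n(\mathbb{C})$ are such that $|\mathrm{Spec}(A^{-1}B)|=r$, $\mathrm{Spec}(A^{-1}B)=\{\lambda_1,\dots,\lambda_r\}$, and that $$A\,\sigma_1\,B=\sum_{i=0}^{r-1}c_i\,A(A^{-1}B)^i,$$ where the coefficients $c_0,\dots,c_{r-1}$ are given by $$c_k=(-1)^{r-1-k}\sum_{i=1}^{r}f(\lambda_i)\,\frac{e_{r-1-k}(\widehat{\lambda_i})}{\prod_{j\neq i}(\lambda_i-\lambda_j)},\qquad 0\leq k\leq r-1.$$ Then $$\Psi(A)\,\sigma_2\,\Psi(B)=\sum_{i=0}^{r-1}c_i\,\Psi(A)\big(\Psi(A)^{-1}\Psi(B)\big)^i.$$ In particular, the decomposition $A\,\sigma_1\,B=\sum_{i=0}^{r-1}c_i\,A(A^{-1}B)^i$ (the expansion in the matrices $A(A^{-1}B)^i$, with the coefficients $c_k=(-1)^{r-1-k}\sum_{i=1}^{r}f(\lambda_i)\,\frac{e_{r-1-k}(\widehat{\lambda_i})}{\prod_{j\neq i}(\lambda_i-\lambda_j)}$, $0\leq k\leq r-1$) is preserved under the embedding $\Psi$, and the coefficients $c_i$ are unchanged.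
   Context: For $\mathbb{D}\in\{\mathbb{R},\mathbb{C}\}$, $\mathscr{P}_n(\mathbb{D})$ is the set of $n\times n$ Hermitian positive definite matrices over $\mathbb{D}$. $\mathrm{Spec}(X)$ is the set of eigenvalues of $X$, without multiplicity. For a continuous $f:(0,\infty)\to\mathbb{R}$ and $X=U\,\mathrm{diag}(\lambda_1,\dots,\lambda_n)\,U^*\in\mathscr{P}_n(\mathbb{D})$ with $UU^*=\mathrm{Id}_n$, set $f(X)=U\,\mathrm{diag}(f(\lambda_1),\dots,f(\lambda_n))\,U^*$. A Kubo-Ando mean on $\mathscr{P}_n(\mathbb{D})$ is a continuous map $\sigma:\mathscr{P}_n(\mathbb{D})\times\mathscr{P}_n(\mathbb{D})\to\mathscr{P}_n(\mathbb{D})$ that is monotone in both arguments for the Loewner order, satisfies $g(A\,\sigma\,B)g^*=(gAg^* )\,\sigma\,(gBg^* )$ for all $g\in\mathrm{GL}_n(\mathbb{D})$, and satisfies $\mathrm{Id}_n\,\sigma\,\mathrm{Id}_n=\mathrm{Id}_n$. By the Kubo-Ando correspondence, used throughout, it is given by $A\,\sigma\,B=A^{1/2}f(A^{-1/2}BA^{-1/2})A^{1/2}$ for a unique operator monotone function $f:(0,\infty)\to(0,\infty)$ with $f(1)=1$, called its representing function. $\widehat{\lambda_i}=(\lambda_1,\dots,\lambda_{i-1},\lambda_{i+1},\dots,\lambda_r)$, and $e_m$ is the elementary symmetric polynomial of degree $m$ in $r-1$ variables, with $e_0=1$. The embedding $\Psi:\mathrm{Mat}_n(\mathbb{C})\to\mathrm{Mat}_{2n}(\mathbb{R})$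 is defined, for real $n\times n$ matrices $P,Q$, by $\Psi(P+iQ)=\begin{pmatrix}P&Q\\-Q&P\end{pmatrix}$. It is an injective homomorphism of real algebras with $\Psi(X^* )=\Psi(X)^t$ and $\Psi(\mathscr{P}_n(\mathbb{C}))\subseteq\mathscr{P}_{2n}(\mathbb{R})$. It is known that for each Kubo-Ando mean $\sigma_1$ on $\mathscr{P}_n(\mathbb{C})$ there is a unique Kubo-Ando mean $\sigma_2$ on $\mathscr{P}_{2n}(\mathbb{R})$ such that $\Psi(A\,\sigma_1\,B)=\Psi(A)\,\sigma_2\,\Psi(B)$ for all $A,B\in\mathscr{P}_n(\mathbb{C})$; this $\sigma_2$ is the mean corresponding to $\sigma_1$. *)

(* Defs.v *)
From HB Require Import structures.
From mathcomp Require Import all_boot all_order all_algebra.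
From mathcomp Require Import all_classical all_reals all_analysis.
From mathcomp Require Import complex.
(* Not imported: its notations clash with those of mathcomp-analysis. *)
From mathcomp Require mpoly.

Set Implicit Arguments.
Unset Strict Implicit.
Unset Printing Implicit Defensive.

Import Order.TTheory GRing.Theory Num.Theory.
Import numFieldNormedType.Exports.

Local Open Scope classical_set_scope.
Local Open Scope ring_scope.
Local Open Scope complex_scope.

(* The field D of the statement. Only the two instances [scalarsR] (D = R, trivial
   conjugation) and [scalarsC] (D = C, complex conjugation) are meant; the
   record lets the definitions below be given once for both. *)
Record scalars (R : realType) := Scalars {
  scalar_sort :> numFieldType;
  scalar_conj : {rmorphism scalar_sort -> scalar_sort};
  of_real : {rmorphism R -> scalar_sort}
}.

Definition scalarsR (R : realType) : scalars R := @Scalars R R idfun idfun.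

Definition scalarsC (R : realType) : scalars R :=
  @Scalars R R[i] Num.conj (real_complex R).

Definition adjmx (R : realType) (D : scalars R) (m n : nat)
    (X : 'M[D]_(m, n)) : 'M[D]_(n, m) :=
  map_mx (scalar_conj D) X^T.

Definition hermmx (R : realType) (D : scalars R) (n : nat)
    (X : 'M[D]_n) : Prop := adjmx X = X.

(* In [numFieldType], [0 < z] (resp. [0 <= z]) entails that z is real. *)
Definition posdefmx (R : realType) (D : scalars R) (n : nat)
    (X : 'M[D]_n) : Prop :=
  hermmx X /\
  forall v : 'cV[D]_n, v != 0 -> 0 < (adjmx v *m X *m v) ord0 ord0.

Definition possemidefmx (R : realType) (D : scalars R) (n : nat)
    (X : 'M[D]_n) : Prop :=
  hermmx X /\
  forall v : 'cV[D]_n, 0 <= (adjmx v *m X *m v) ord0 ord0.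

Definition loewner_le (R : realType) (D : scalars R) (n : nat)
    (X Y : 'M[D]_n) : Prop := possemidefmx (Y - X).

Definition Spec (F : fieldType) (n : nat) (X : 'M[F]_n) : set F :=
  [set a | eigenvalue X a].

(* [is_fcalc f X Y]: X = U diag(l) U^* and Y = U diag(f(l)) U^*, for some U with
   U U^* = 1. For a given X in P_n there is exactly one such Y. *)
Definition is_fcalc (R : realType) (D : scalars R) (n : nat) (f : R -> R)
    (X Y : 'M[D]_n) : Prop :=
  exists (U : 'M[D]_n) (l : 'rV[R]_n),
    [/\ U *m adjmx U = 1%:M,
        X = U *m diag_mx (map_mx (of_real D) l) *m adjmx U &
        Y = U *m diag_mx (map_mx (of_real D) (map_mx f l)) *m adjmx U].

Definition fcalc (R : realType) (D : scalars R) (n : nat) (f : R -> R)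
    (X : 'M[D]_n) : 'M[D]_n := xget 0 [set Y | is_fcalc f X Y].

Definition sqrtmx (R : realType) (D : scalars R) (n : nat)
    (X : 'M[D]_n) : 'M[D]_n := fcalc Num.sqrt X.

(* Functions on (0, oo) and maps on P_n x P_n are represented by total functions
   whose values outside of these domains are unconstrained and never used. *)

Definition operator_monotone (R : realType) (f : R -> R) : Prop :=
  (forall t : R, 0 < t -> {for t, continuous f}) /\
  forall (m : nat) (X Y : 'M[scalarsC R]_m),
    posdefmx X -> posdefmx Y -> loewner_le X Y ->
    loewner_le (fcalc f X) (fcalc f Y).

Definition kubo_ando_mean (R : realType) (D : scalars R) (n : nat)
    (sigma : 'M[D]_n -> 'M[D]_n -> 'M[D]_n) : Prop :=
  [/\ forall A B, posdefmx A -> posdefmx B -> posdefmx (sigma A B),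
      {within [set AB : 'M[D]_n * 'M[D]_n | posdefmx AB.1 /\ posdefmx AB.2],
        continuous (fun AB => sigma AB.1 AB.2)},
      forall A A' B B', posdefmx A -> posdefmx A' -> posdefmx B -> posdefmx B' ->
        loewner_le A A' -> loewner_le B B' ->
        loewner_le (sigma A B) (sigma A' B'),
      forall g A B, g \in unitmx -> posdefmx A -> posdefmx B ->
        g *m sigma A B *m adjmx g =
        sigma (g *m A *m adjmx g) (g *m B *m adjmx g) &
      sigma 1%:M 1%:M = 1%:M].

Definition representing_function (R : realType) (D : scalars R) (n : nat)
    (sigma : 'M[D]_n -> 'M[D]_n -> 'M[D]_n) (f : R -> R) : Prop :=
  [/\ forall t : R, 0 < t -> 0 < f t,
      operator_monotone f,
      f 1 = 1 &
      forall A B, posdefmx A -> posdefmx B ->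
        sigma A B =
        sqrtmx A *m fcalc f (invmx (sqrtmx A) *m B *m invmx (sqrtmx A))
                 *m sqrtmx A].

Definition Psi (R : realType) (n : nat) (X : 'M[R[i]]_n) : 'M[R]_(n + n) :=
  block_mx (map_mx (@complex.Re R) X) (map_mx (@complex.Im R) X)
           (- map_mx (@complex.Im R) X) (map_mx (@complex.Re R) X).

Definition corresponding_means (R : realType) (n : nat)
    (sigma1 : 'M[R[i]]_n -> 'M[R[i]]_n -> 'M[R[i]]_n)
    (sigma2 : 'M[R]_(n + n) -> 'M[R]_(n + n) -> 'M[R]_(n + n)) : Prop :=
  forall A B : 'M[R[i]]_n,
    posdefmx (D := scalarsC R) A -> posdefmx (D := scalarsC R) B ->
    Psi (sigma1 A B) = sigma2 (Psi A) (Psi B).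

(* The tuple (lambda_1, ..., lambda_r) with its i-th entry removed. *)
Definition omit (R : realType) (r : nat) (lam : 'I_r -> R) (i : 'I_r) :
    'I_r.-1 -> R := fun j => lam (lift i j).

Definition esym (R : realType) (s m : nat) (v : 'I_s -> R) : R :=
  mpoly.meval v (mpoly.mesym s R m).

Definition mean_coef (R : realType) (f : R -> R) (r : nat) (lam : 'I_r -> R)
    (k : nat) : R :=
  (-1) ^+ (r.-1 - k)%N *
  \sum_(i < r) f (lam i) * (esym (r.-1 - k)%N (omit lam i) /
                            \prod_(j < r | j != i) (lam i - lam j)).

(* Main.v *)
(* Psi is a homomorphism of real algebras, so it carries the decomposition of
   [sigma1 A B] to that of [sigma2 (Psi A) (Psi B)]. The real eigenvalues of
   [Psi X] are those of [X], so the nodes lambda_i are the same. Since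
   [sigma 1 (t 1) = f(t) 1] for a mean with representing function f, and Psi maps
   scalar matrices to scalar matrices, the representing functions of the two
   means agree on (0, oo), where the lambda_i lie. *)

Require Import Defs.
From mathcomp Require Import all_boot all_order all_algebra.
From mathcomp Require Import all_classical all_reals all_analysis.
From mathcomp Require Import complex.

Import Order.TTheory GRing.Theory Num.Theory.
Import numFieldNormedType.Exports.

Local Open Scope classical_set_scope.
Local Open Scope ring_scope.
Local Open Scope complex_scope.

(** * The embedding [Psi] as a homomorphism of real algebras, and its effect on real eigenvalues *)

Lemma Re_mulmx (R : realType) (m n p : nat) (X : 'M[R[i]]_(m, n))
    (Y : 'M[R[i]]_(n, p)) :
  map_mx (@complex.Re R) (X *m Y) =
  map_mx (@complex.Re R) X *m map_mx (@complex.Re R) Y -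
  map_mx (@complex.Im R) X *m map_mx (@complex.Im R) Y.
Proof.
(* [Rcomplex R] is [R[i]] seen as a real vector space, on which [Re] is known to be additive. *)
apply/matrixP => i j; rewrite !mxE (raddf_sum (@complex.Re R : Rcomplex R -> R)).
rewrite -sumrB; apply: eq_bigr => k _; rewrite !mxE.
by case: (X i k) (Y k j) => [a b] [c d].
Qed.

Lemma Im_mulmx (R : realType) (m n p : nat) (X : 'M[R[i]]_(m, n))
    (Y : 'M[R[i]]_(n, p)) :
  map_mx (@complex.Im R) (X *m Y) =
  map_mx (@complex.Re R) X *m map_mx (@complex.Im R) Y +
  map_mx (@complex.Im R) X *m map_mx (@complex.Re R) Y.
Proof.
apply/matrixP => i j; rewrite !mxE (raddf_sum (@complex.Im R : Rcomplex R -> R)).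
rewrite -big_split; apply: eq_bigr => k _; rewrite !mxE.
by case: (X i k) (Y k j) => [a b] [c d].
Qed.

Lemma Psi_mulmx (R : realType) (n : nat) (X Y : 'M[R[i]]_n) :
  Psi (X *m Y) = Psi X *m Psi Y.
Proof.
rewrite /Psi mulmx_block !Re_mulmx !Im_mulmx !mulNmx !mulmxN.
by congr block_mx; rewrite ?opprD // addrC.
Qed.

Lemma PsiD (R : realType) (n : nat) (X Y : 'M[R[i]]_n) :
  Psi (X + Y) = Psi X + Psi Y.
Proof.
rewrite /Psi add_block_mx -opprD.
by congr block_mx; [| |congr (- _)|]; apply/matrixP => i j;
  rewrite !mxE; case: (X i j) (Y i j) => [a b] [c d].
Qed.

Lemma PsiZ (R : realType) (n : nat) (a : R) (X : 'M[R[i]]_n) :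
  Psi (a%:C *: X) = a *: Psi X.
Proof.
rewrite /Psi scale_block_mx scalerN.
by congr block_mx; [| |congr (- _)|]; apply/matrixP => i j;
  rewrite !mxE; case: (X i j) => [b c] /=; rewrite mul0r ?subr0 ?addr0.
Qed.

Lemma Psi_scalar (R : realType) (n : nat) (a : R) :
  Psi (a%:C%:M : 'M[R[i]]_n) = a%:M.
Proof.
rewrite /Psi (scalar_mx_block n n).
by congr block_mx; apply/matrixP => i j; rewrite !mxE; case: eqP;
  rewrite /= ?oppr0.
Qed.

Lemma Psi1 (R : realType) (n : nat) : Psi (1%:M : 'M[R[i]]_n) = 1%:M.
Proof. exact: Psi_scalar. Qed.

Lemma Psi_sum (R : realType) (n r : nat) (F : 'I_r -> 'M[R[i]]_n) :
  Psi (\sum_(i < r) F i) = \sum_(i < r) Psi (F i).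
Proof.
apply: (big_morph _ (@PsiD R n)).
(* The zero matrix is the scalar matrix of 0. *)
have := Psi_scalar R n 0; rewrite !raddf0 //.
Qed.

Lemma Psi_exp (R : realType) (n : nat) (X : 'M[R[i]]_n) (k : nat) :
  Psi (X ^+ k) = Psi X ^+ k.
Proof.
elim: k => [|k IH]; first by rewrite !expr0 Psi1.
by rewrite !exprS -IH; apply: Psi_mulmx.
Qed.

Lemma Psi_invmx (R : realType) (n : nat) (X : 'M[R[i]]_n) :
  X \in unitmx -> Psi (invmx X) = invmx (Psi X).
Proof.
move=> uX; have XV : Psi X *m Psi (invmx X) = 1%:M.
  by rewrite -Psi_mulmx mulmxV // Psi1.
have [uPX _] := mulmx1_unit XV.
by rewrite -[LHS](mulKmx uPX) XV mulmx1.
Qed.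

(* [w |-> row_mx (Re w) (Im w)] intertwines [X] with [Psi X], acting on row
   vectors from the right. *)
Lemma eigenvalue_Psi (R : realType) (n : nat) (X : 'M[R[i]]_n) (a : R) :
  eigenvalue (Psi X) a = eigenvalue X a%:C.
Proof.
pose reim (w : 'rV[R[i]]_n) :=
  row_mx (map_mx (@complex.Re R) w) (map_mx (@complex.Im R) w).
have reimM w : reim (w *m X) = reim w *m Psi X.
  by rewrite /reim /Psi mul_row_block Re_mulmx Im_mulmx mulmxN.
have reimZ w : reim (a%:C *: w) = a *: reim w.
  rewrite /reim scale_row_mx.
  by congr row_mx; apply/matrixP => i j; rewrite !mxE; case: (w i j) => b c /=;
    rewrite mul0r ?subr0 ?addr0.
have reim_inj : injective reim.
  move=> u v /eq_row_mx[/matrixP e1 /matrixP e2]; apply/matrixP => i j.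
  move: (e1 i j) (e2 i j); rewrite !mxE.
  by case: (u i j) (v i j) => [b c] [d e] /= -> ->.
have reim0 : reim 0 = 0.
  by rewrite /reim -[RHS]row_mx0; congr row_mx; apply/matrixP => i j; rewrite !mxE.
apply/eigenvalueP/eigenvalueP => [[v vX v0]|[w wX w0]].
  (* The two halves of [v] serve as real and imaginary parts, which inverts [reim]. *)
  pose w : 'rV[R[i]]_n := \row_j (lsubmx v 0 j +i* rsubmx v 0 j).
  have wv : reim w = v.
    rewrite -[RHS]hsubmxK /reim.
    by congr row_mx; apply/matrixP => i j; rewrite !mxE /= (ord1 i).
  exists w; first by apply: reim_inj; rewrite reimM reimZ wv.
  by apply: contraNneq v0 => w0; rewrite -wv w0 reim0.
exists (reim w); first by rewrite -reimM wX reimZ.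
by apply: contraNneq w0 => rw; apply/eqP/reim_inj; rewrite rw reim0.
Qed.

(** * Functional calculus and means at scalar matrices *)

Lemma is_fcalc_scalar (R : realType) (D : scalars R) (n : nat) (f : R -> R)
    (t : R) (Y : 'M[D]_n) :
  is_fcalc f (of_real D t)%:M Y <-> Y = (of_real D (f t))%:M.
Proof.
split=> [[U [l [UU tE ->]]]|->]; last first.
  exists 1%:M, (const_mx t); rewrite /adjmx trmx1 map_mx1 !mulmx1 !mul1mx.
  by rewrite !map_const_mx !diag_const_mx.
have UU' := mulmx1C UU.
(* Conjugation by a unitary matrix fixes scalar matrices, so every diagonalization of t Id has
   constant diagonal t, whatever [U] is. *)
have lt i : l 0 i = t.
  have : adjmx U *m (of_real D t)%:M *m U = diag_mx (map_mx (of_real D) l).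
    by rewrite [in LHS]tE !mulmxA UU' mul1mx -mulmxA UU' mulmx1.
  rewrite mul_mx_scalar -scalemxAl UU' scalemx1 => /matrixP/(_ i i).
  by rewrite !mxE eqxx !mulr1n => /fmorph_inj.
have -> : map_mx (of_real D) (map_mx f l) = const_mx (of_real D (f t)).
  by apply/matrixP => i j; rewrite !mxE (ord1 i) lt.
by rewrite diag_const_mx mul_mx_scalar -scalemxAl UU scalemx1.
Qed.

Lemma fcalc_scalar (R : realType) (D : scalars R) (n : nat) (f : R -> R)
    (t : R) :
  fcalc f (of_real D t)%:M = (of_real D (f t))%:M :> 'M[D]_n.
Proof.
by apply: xget_unique => [|Y]; rewrite /= is_fcalc_scalar.
Qed.

(** The square root of Id is Id, so the Kubo-Ando formula collapses to the functional calculus at t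
    Id; this recovers f from the mean. *)
Lemma representing_function_scalar (R : realType) (D : scalars R) (n : nat)
    (sigma : 'M[D]_n -> 'M[D]_n -> 'M[D]_n) (f : R -> R) (t : R) :
  representing_function sigma f ->
  posdefmx (1%:M : 'M[D]_n) -> posdefmx ((of_real D t)%:M : 'M[D]_n) ->
  sigma 1%:M (of_real D t)%:M = (of_real D (f t))%:M.
Proof.
case=> _ _ _ sigmaE p1 pt; rewrite sigmaE //.
have -> : sqrtmx (1%:M : 'M[D]_n) = 1%:M.
  by rewrite /sqrtmx -(rmorph1 (of_real D)) fcalc_scalar sqrtr1.
by rewrite invmx1 !mulmx1 !mul1mx fcalc_scalar.
Qed.

(** * Positive definiteness and positivity of the spectrum *)

(** The record [scalars] does not relate the conjugation to the order, so positivity of conj(x) x is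
    assumed here and checked below for each of the two fields. *)
Lemma posdefmx_scalar (R : realType) (D : scalars R) (n : nat) (a : D) :
  (forall x : D, x != 0 -> 0 < scalar_conj D x * x) ->
  scalar_conj D a = a -> 0 < a -> posdefmx (a%:M : 'M[D]_n).
Proof.
move=> conj_gt0 aJ a_gt0; split.
  by rewrite /hermmx /adjmx tr_scalar_mx map_scalar_mx aJ.
move=> v v0; rewrite mul_mx_scalar -scalemxAl mxE mulr_gt0 // mxE.
have conj_ge0 (x : D) : 0 <= scalar_conj D x * x.
  by have [->|/conj_gt0/ltW//] := eqVneq x 0; rewrite mulr0.
(* A nonzero coordinate contributes a positive term to the sum of the conj(v_k) v_k, and the other
   terms are nonnegative. *)
have [i vi] : exists i, v i 0 != 0.
  apply/existsP; apply: contraNT v0; rewrite negb_exists => /forallP v0.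
  by apply/eqP/matrixP => i j; rewrite (ord1 j) mxE; apply/eqP/negbNE/v0.
rewrite (bigD1 i) //= !mxE ltr_pwDl ?conj_gt0 //.
by apply: sumr_ge0 => k _; rewrite !mxE.
Qed.

Lemma posdefmx_scalarC (R : realType) (n : nat) (t : R) :
  0 < t -> posdefmx (D := scalarsC R) (t%:C%:M : 'M[R[i]]_n).
Proof.
move=> t_gt0; apply: (@posdefmx_scalar R (scalarsC R) n t%:C).
- by move=> x x0; rewrite /= mulrC -normCK exprn_gt0 // normr_gt0.
- exact: conjc_real.
- by rewrite ltcR.
Qed.

Lemma posdefmx_scalarR (R : realType) (n : nat) (t : R) :
  0 < t -> posdefmx (D := scalarsR R) (t%:M : 'M[R]_n).
Proof.
move=> t_gt0; apply: (@posdefmx_scalar R (scalarsR R)) => //.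
by move=> x x0; rewrite /= -expr2 exprn_even_gt0.
Qed.

(** Row-vector form of positivity, suited to [eigenvalue] and [kermx], which act on rows: the
    definition is applied to the column w^*. *)
Lemma posdefmx_row (R : realType) (n : nat) (A : 'M[R[i]]_n)
    (w : 'rV[R[i]]_n) :
  posdefmx (D := scalarsC R) A -> w != 0 ->
  0 < (w *m A *m map_mx Num.conj w^T) 0 0.
Proof.
case=> _ /(_ (map_mx Num.conj w^T)) + w0.
have -> : adjmx (D := scalarsC R) (map_mx Num.conj w^T) = w.
  by apply/matrixP => i j; rewrite !mxE /= conjCK.
apply; apply: contraNneq w0 => /matrixP e.
apply/eqP/matrixP => i j; move: (e j i).
by rewrite !mxE => /eqP; rewrite conjC_eq0 => /eqP.
Qed.

Lemma posdefmx_unit (R : realType) (n : nat) (A : 'M[R[i]]_n) :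
  posdefmx (D := scalarsC R) A -> A \in unitmx.
Proof.
move=> pA; rewrite -row_free_unit -kermx_eq0; apply/rowV0P => w /sub_kermxP wA.
apply: contraTeq isT => w0; have := posdefmx_row _ _ _ _ pA w0.
by rewrite wA mul0mx mxE ltxx.
Qed.

Lemma eigenvalue_gt0 (R : realType) (n : nat) (A B : 'M[R[i]]_n) (a : R[i]) :
  posdefmx (D := scalarsC R) A -> posdefmx (D := scalarsC R) B ->
  eigenvalue (invmx A *m B) a -> 0 < a.
Proof.
move=> pA pB /eigenvalueP[v vE v0]; have uA := posdefmx_unit _ _ _ pA.
pose w := v *m invmx A.
have w0 : w != 0.
  by apply: contraNneq v0 => w0; rewrite -(mulmxKV uA v) -/w w0 mul0mx.
have := posdefmx_row _ _ _ _ pB w0.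
rewrite /w -[v *m _ *m B]mulmxA vE -{1}(mulmxKV uA v) -/w -!scalemxAl mxE.
by rewrite pmulr_lgt0 // posdefmx_row.
Qed.

(** * Transfer from [sigma1] to [sigma2] *)

Lemma representing_function_corr (R : realType) (n : nat) (hn : (0 < n)%N)
    (sigma1 : 'M[R[i]]_n -> 'M[R[i]]_n -> 'M[R[i]]_n)
    (sigma2 : 'M[R]_(n + n) -> 'M[R]_(n + n) -> 'M[R]_(n + n))
    (f1 f2 : R -> R) (t : R) :
  representing_function (D := scalarsC R) sigma1 f1 ->
  representing_function (D := scalarsR R) sigma2 f2 ->
  corresponding_means sigma1 sigma2 -> 0 < t -> f1 t = f2 t.
Proof.
move=> rf1 rf2 h12 t_gt0.
have p1C := posdefmx_scalarC R n 1 ltr01.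
have ptC := posdefmx_scalarC R n t t_gt0.
have p1R := posdefmx_scalarR R (n + n) 1 ltr01.
have ptR := posdefmx_scalarR R (n + n) t t_gt0.
have := h12 _ _ p1C ptC.
rewrite Psi1 (representing_function_scalar _ (scalarsC R) n _ _ t rf1 p1C ptC).
rewrite !Psi_scalar.
rewrite (representing_function_scalar _ (scalarsR R) _ _ _ t rf2 p1R ptR).
(* Since n is positive there is a diagonal entry, at which the two equal scalar matrices show [f1 t]
   and [f2 t]. *)
move=> /matrixP/(_ (lshift n (Ordinal hn)) (lshift n (Ordinal hn))).
by rewrite !mxE eqxx !mulr1n.
Qed.

Theorem theorem6p1 (R : realType) (n : nat) (hn : (0 < n)%N)
    (sigma1 : 'M[R[i]]_n -> 'M[R[i]]_n -> 'M[R[i]]_n) (f : R -> R)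
    (hsigma1 : kubo_ando_mean (D := scalarsC R) sigma1)
    (hf : representing_function (D := scalarsC R) sigma1 f)
    (sigma2 : 'M[R]_(n + n) -> 'M[R]_(n + n) -> 'M[R]_(n + n))
    (hsigma2 : kubo_ando_mean (D := scalarsR R) sigma2)
    (hsigma12 : corresponding_means sigma1 sigma2)
    (A B : 'M[R[i]]_n)
    (hA : posdefmx (D := scalarsC R) A) (hB : posdefmx (D := scalarsC R) B)
    (r : nat) (lam : 'I_r -> R)
    (hr : (Spec (invmx A *m B) #= `I_r)%card)
    (hlam : Spec (invmx A *m B) = range (fun i : 'I_r => (lam i)%:C))
    (c : 'I_r -> R)
    (hc : forall k : 'I_r, c k = mean_coef f lam k)
    (hdec : sigma1 A B =
            \sum_(i < r) (c i)%:C *: (A *m (invmx A *m B) ^+ i)) :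
  sigma2 (Psi A) (Psi B) =
    \sum_(i < r) c i *: (Psi A *m (invmx (Psi A) *m Psi B) ^+ i) /\
  (* the same c_i are the coefficients given by the formula for sigma2, Psi A
     and Psi B *)
  [/\ (Spec (invmx (Psi A) *m Psi B) #= `I_r)%card,
      Spec (invmx (Psi A) *m Psi B) = range lam &
      forall f2 : R -> R, representing_function (D := scalarsR R) sigma2 f2 ->
        forall k : 'I_r, c k = mean_coef f2 lam k].
Proof.
have uA := posdefmx_unit R n A hA.
have PsiAB : Psi (invmx A *m B) = invmx (Psi A) *m Psi B.
  by rewrite Psi_mulmx Psi_invmx.
(* [eigenvalue_Psi] only sees real eigenvalues; by [hlam] every eigenvalue of A^{-1} B is some real
   [lam i], so none is lost. *)
have specE : Spec (invmx A *m B) = real_complex R @` Spec (Psi (invmx A *m B)).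
  apply/seteqP; split=> [a|_ [a + <-]]; last by rewrite /Spec /= eigenvalue_Psi.
  move=> /[dup]; rewrite {1}hlam => -[i _ <-] ei.
  by exists (lam i) => //; rewrite /Spec /= eigenvalue_Psi.
split.
  rewrite -hsigma12 // hdec Psi_sum; apply: eq_bigr => i _.
  by rewrite PsiZ Psi_mulmx Psi_exp PsiAB.
rewrite -PsiAB; split.
- apply: card_eq_trans hr; rewrite specE card_eq_sym; apply: inj_card_eq.
  by move=> x y _ _; apply: fmorph_inj.
- apply/seteqP; split=> [a|_ [i _ <-]].
    rewrite /Spec /= eigenvalue_Psi => ea.
    have : Spec (invmx A *m B) a%:C by [].
    by rewrite hlam => -[i _ /fmorph_inj <-]; exists i.
  rewrite /Spec /= eigenvalue_Psi.
  suff : Spec (invmx A *m B) (lam i)%:C by [].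
  by rewrite hlam; exists i.
- move=> f2 rf2 k; rewrite hc /mean_coef; congr (_ * _).
  apply: eq_bigr => i _; congr (_ * _).
  apply: (@representing_function_corr R n hn sigma1 sigma2) => //.
  (* The coefficients involve f only through its values at the [lam i]. These are eigenvalues of
     A^{-1} B, hence positive, and there [f] and [f2] agree. *)
  have : Spec (invmx A *m B) (lam i)%:C by rewrite hlam; exists i.
  by move=> /(eigenvalue_gt0 _ _ _ _ _ hA hB); rewrite ltcR.
Qed.
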